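(* Let $\{T_n\}_{n\ge1}$ be any family of trees such that $T_n$ has $n$ vertices, and let $T_\lambda=T_{\lambda_1}\cup\dots\cup T_{\lambda_{\ell(\lambda)}}$ (disjoint union) for a partition $\lambda$; then $\{X_{T_\lambda}\}_\lambda$ is a basis of $\Lambda$. For every weighted graph $(G,\omega)$ and every $k\in\mathbb{N}$, \[\sum_{\lambda:\ \ell(\lambda)=k}[X_{T_\lambda}]X_{(G,\omega)}=\sum_{\lambda:\ \ell(\lambda)=k}[X_{P_\lambda}]X_{(G,\omega)}.\] In particular the polynomial obtained from $X_{(G,\omega)}$ by expanding in the basis $\{X_{T_\lambda}\}$ and replacing each $X_{T_\lambda}$ by $x^{\ell(\lambda)}$ is independent of the choice of the family $\{T_n\}$ and equals $\tau_{(G,\omega)}$.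
   Context: A weighted graph $(G,\omega)$ is a finite simple graph with $\omega:V(G)\to\{1,2,\dots\}$, and $X_{(G,\omega)}=\sum_\kappa\prod_{v\in V(G)}x_{\kappa(v)}^{\omega(v)}$, summed over proper colourings $\kappa:V(G)\to\{1,2,\dots\}$; unweighted graphs correspond to $\omega\equiv1$. $P_n$ is the path on $n$ vertices and $P_\lambda$ the disjoint union of $P_{\lambda_i}$; $\{X_{P_\lambda}\}$ is a basis of the algebra $\Lambda$ of symmetric functions over $\mathbb{Q}$. $[b]f$ denotes the coefficient of basis element $b$ in $f$. For $f=\sum_\lambda a_\lambda X_{P_\lambda}$, $\tau_f(x)=\sum_\lambda a_\lambda x^{\ell(\lambda)}$ and $\tau_{(G,\omega)}=\tau_{X_{(G,\omega)}}$. *)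

(* Defs.v *)
From HB Require Import structures.
From mathcomp Require Import all_boot all_order all_algebra.
Set Implicit Arguments. Unset Strict Implicit. Unset Printing Implicit Defensive.
Import Order.TTheory GRing.Theory Num.Theory.
Local Open Scope ring_scope.

Definition is_part (l : seq nat) : bool :=
  sorted geq l && all (fun x => 0 < x)%N l.

(* The algebra Lambda of symmetric functions over Q is modelled through its
   monomial basis: f = \sum_mu f mu * m_mu, where only the values of
   f on partitions matter, and f must have finite support. *)
Definition symf := seq nat -> rat.

Definition in_Lambda (f : symf) : Prop :=
  exists N : nat, forall mu, is_part mu -> (N < sumn mu)%N -> f mu = 0.

Definition sym_eq (f g : symf) : Prop := forall mu, is_part mu -> f mu = g mu.

Definition proper (V : finType) (e : rel V) (m : nat) (k : {ffun V -> 'I_m}) :=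
  [forall u, forall v, e u v ==> (k u != k v)].

(* Coefficient of the monomial x_1^{mu_1} ... x_l^{mu_l} in X_(G,w), i.e. the
   number of proper colourings k with  sum_{k(v)=i} w(v) = mu_i  for all i
   (for a partition mu and positive weights, colours > l(mu) cannot occur). *)
Definition Xcoef (V : finType) (e : rel V) (w : V -> nat) (mu : seq nat) : rat :=
  (#|[set k : {ffun V -> 'I_(size mu)} | proper e k &&
      [forall i : 'I_(size mu), (\sum_(v | k v == i) w v)%N == nth 0%N mu i]]|)%:R.

Definition Xg (V : finType) (e : rel V) (w : V -> nat) : symf := Xcoef e w.

Definition is_tree (n : nat) (r : rel 'I_n) : Prop :=
  [/\ symmetric r, irreflexive r,
      (forall x y, connect r x y) &
      (forall p : seq 'I_n, uniq p -> (3 <= size p)%N -> ~~ cycle r p)].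

Definition path_rel (n : nat) : rel 'I_n :=
  fun i j => (i.+1 == j :> nat) || (j.+1 == i :> nat).

Definition uvert (lam : seq nat) : finType :=
  {i : 'I_(size lam) & 'I_(nth 0%N lam i)}.

Definition uedge (t : forall n : nat, rel 'I_n) (lam : seq nat) : rel (uvert lam) :=
  fun u v => (tag u == tag v) && t _ (tagged u) (tagged_as u v).

Definition XT (t : forall n : nat, rel 'I_n) (lam : seq nat) : symf :=
  Xg (@uedge t lam) (fun _ => 1%N).

Definition valid_idx (s : seq (seq nat)) : Prop := uniq s /\ all is_part s.

Definition lincomb (s : seq (seq nat)) (a : seq nat -> rat) (B : seq nat -> symf) : symf :=
  fun mu => \sum_(l <- s) a l * B l mu.

(* Main.v *)
(* Rooting every tree at its vertex 0 and expanding the product over non-root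
   vertices of (1 - [v and its parent have the same colour]) gives
     X_{T_l} = \sum_S (-1)^|S| p_{type S},
   where S runs over the sets of edges (identified with non-root vertices) and
   type S lists the sizes of the components of S, so type S has n - |S| parts.
   Type S is longer than l unless S contains every edge, so the passage from X_T
   to p is triangular; so is the passage from p to m, in the opposite direction.
   The specialization p_nu |-> x^len(nu) (x-1)^(|nu|-len(nu)) maps X_{T_l} to
   \sum_S x^(n-|S|) (1-x)^|S| = x^len(l) by the binomial theorem, whatever the
   trees, and hence computes tau. *)

Require Import Defs.
From HB Require Import structures.
From mathcomp Require Import all_boot all_order all_algebra.
Import Order.TTheory GRing.Theory Num.Theory.
Local Open Scope ring_scope.

Set Implicit Arguments. Unset Strict Implicit. Unset Printing Implicit Defensive.

(** * Subset expansion of a product of sums *)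

Lemma prod_add_subsets (R : comPzRingType) (V : finType) (N : {set V})
    (F G : V -> R) :
  \prod_(v in N) (F v + G v) =
  \sum_(S : {set V} | S \subset N)
     (\prod_(v in S) F v) * \prod_(v in N :\: S) G v.
Proof.
rewrite big_mkcond /=.
(* Outside [N] the factor becomes [0 + 1], so a subset not contained in [N] contributes 0. *)
pose F' v := if v \in N then F v else 0.
pose G' v := if v \in N then G v else 1.
rewrite (eq_bigr (fun v => F' v + G' v)); last first.
  by move=> v _; rewrite /F' /G'; case: ifP; rewrite ?add0r.
rewrite bigA_distr [LHS](bigID (fun S : {set V} => S \subset N)) /=.
rewrite [X in _ + X]big1 ?addr0 => [|S /subsetPn[v vS vN]]; last first.
  by rewrite (bigD1 v) //= vS /F' (negPf vN) mul0r.
apply: eq_bigr => S SN; rewrite (bigID (mem S)) /=; congr (_ * _).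
  by apply: eq_bigr => v vS; rewrite vS /F' (subsetP SN).
rewrite big_mkcond /= [RHS]big_mkcond /=; apply: eq_bigr => v _.
by rewrite inE /G'; case: (v \in S) => //=; case: (v \in N).
Qed.

(** * Power sums in the monomial basis *)

(* The coefficient of m_mu in the power sum p_l. *)
Definition pcoef (l mu : seq nat) : rat :=
  #|[set k : {ffun 'I_(size l) -> 'I_(size mu)} |
      [forall i : 'I_(size mu),
         (\sum_(v | k v == i) nth 0%N l v)%N == nth 0%N mu i]]|%:R.

Lemma part_nth_gt0 l i : is_part l -> (i < size l)%N -> (0 < nth 0%N l i)%N.
Proof. by case/andP=> _ /allP h il; apply/h/mem_nth. Qed.

Lemma part_perm_eq l mu : is_part l -> is_part mu -> perm_eq l mu -> l = mu.
Proof.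
case/andP=> sl _ /andP[sm _]; apply: sorted_eq sl sm.
  by move=> a b c h1 h2; apply: leq_trans h2 h1.
by move=> a b /andP[h1 h2]; apply/anti_leq/andP.
Qed.

Lemma map_nth_enum (l : seq nat) : [seq nth 0%N l (val i) | i <- enum 'I_(size l)] = l.
Proof. by rewrite (map_comp (nth 0%N l)) val_enum_ord map_nth_iota0 ?take_size. Qed.

Lemma sum_nth_sumn (l : seq nat) : (\sum_(i < size l) nth 0 l i)%N = sumn l.
Proof. by rewrite sumnE (big_nth 0%N) big_mkord. Qed.

(** A map counted by [pcoef] merges the parts of [l] into those of [mu]. The parts of [mu] are
    positive, so it is surjective; when the lengths agree it is a bijection and [mu] rearranges
    [l]. *)
Lemma pcoef_neq0 l mu : is_part l -> is_part mu -> pcoef l mu != 0 ->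
  sumn mu = sumn l /\ (mu = l \/ (size mu < size l)%N).
Proof.
move=> hl hm; rewrite /pcoef pnatr_eq0 cards_eq0 => /set0Pn[k].
rewrite inE => /forallP /= hk; split.
  rewrite -!sum_nth_sumn [RHS](partition_big k predT) //=.
  by apply: eq_bigr => i _; rewrite -(eqP (hk i)).
have surj i : exists v, k v = i.
  have := part_nth_gt0 hm (ltn_ord i); rewrite -(eqP (hk i)) => h.
  case: (pickP (fun v => k v == i)) => [v /eqP <-|h0]; first by exists v.
  by move: h; rewrite big_pred0.
have ssub : codom k =i predT.
  by move=> i; have [v <-] := surj i; rewrite codom_f.
have cimg : #|codom k| = size mu by rewrite (eq_card ssub) card_ord.
have le : (size mu <= size l)%N.
  by rewrite -cimg -[X in (_ <= X)%N]card_ord; apply: leq_image_card.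
case: (ltnP (size mu) (size l)) => [|ge]; first by right.
left; have eqs : size mu = size l by apply/eqP; rewrite eqn_leq le.
have kinj : injective k.
  by apply/injectiveP/card_uniqP; rewrite cimg size_map -cardE card_ord.
apply/esym/part_perm_eq => //; rewrite -(map_nth_enum l) -[X in perm_eq _ X]map_nth_enum.
have -> : [seq nth 0%N l (val i) | i <- enum 'I_(size l)] =
          [seq nth 0%N mu (val i) | i <- [seq k i | i <- enum 'I_(size l)]].
  rewrite -[RHS]map_comp; apply/eq_in_map => v _ /=.
  by rewrite -(eqP (hk (k v))) (big_pred1 v) // => u; rewrite /= (inj_eq kinj).
apply: perm_map; apply: uniq_perm; first by rewrite (map_inj_uniq kinj) enum_uniq.
  exact: enum_uniq.
by move=> i; rewrite mem_enum; have := ssub i.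
Qed.

Lemma pcoef_diag l : pcoef l l != 0.
Proof.
rewrite /pcoef pnatr_eq0 cards_eq0; apply/set0Pn; exists [ffun i => i].
rewrite inE; apply/forallP => i; rewrite (big_pred1 i) // => v.
by rewrite ffunE.
Qed.

Lemma prod_natr_bool (R : comPzRingType) (V : finType) (A : {set V}) (b : pred V) :
  \prod_(v in A) (b v)%:R = [forall v in A, b v]%:R :> R.
Proof.
case: forallP => [h|/forallP/forallPn[v]].
  by apply: big1 => v vA; move/implyP: (h v) => ->.
by rewrite negb_imply => /andP[vA /negPf bv]; rewrite (bigD1 v) //= bv mul0r.
Qed.

(** * Edge subsets of a rooted forest and their component sizes *)

Section RootedForest.

Variables (V : finType) (par : V -> V) (h : V -> nat) (N : {set V}).
Hypothesis par_lt : {in N, forall v, h (par v) < h v}%N.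

Definition climb (S : {set V}) v := if v \in S then par v else v.

(* The top of the component of v in the forest with edges {u, par u}, u in S;
   \max_u h u steps always suffice. *)
Definition top (S : {set V}) v := iter (\max_u h u) (climb S) v.

Definition block (S : {set V}) u := #|[set v | top S v == u]|.

(** For [S] inside [N], each component has exactly one vertex outside [S], its top. Sorting by
    component size makes [forest_type] a partition. *)
Definition tops (S : {set V}) : seq V := sort (relpre (block S) geq) (enum (~: S)).

Definition forest_type (S : {set V}) : seq nat := map (block S) (tops S).

(** Each step out of a vertex of [S] lowers [h]. A vertex still in [S] after [\max_u h u] steps
    would have height 0, yet its parent would be lower still. *)
Lemma topN (S : {set V}) v : S \subset N -> top S v \notin S.
Proof.
move=> /subsetP SN; apply/negP => tS.
have climbed i : iter i (climb S) v \in S -> (h (iter i (climb S) v) + i <= h v)%N.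
  elim: i => [|i IH] /=; first by rewrite addn0.
  rewrite [climb S (iter _ _ _)]/climb; case: ifP => [iS _|->] //.
  by apply: leq_trans (IH iS); rewrite addnS -addSn leq_add2r par_lt ?SN.
have := climbed _ tS; have := par_lt (SN _ tS).
have := leq_bigmax (F := h) v; rewrite -/(top S v).
move: (h (par _)) (h (top S v)) (h v) (\max_u h u) => a b c d cd ab bd.
by have := leq_trans bd cd; rewrite -{2}(add0n d) leq_add2r leqn0 => /eqP b0; rewrite b0 in ab.
Qed.

Lemma top_id (S : {set V}) v : v \notin S -> top S v = v.
Proof.
move=> vS; rewrite /top; elim: (\max_u _)%N => //= i ->.
by rewrite /climb (negPf vS).
Qed.

Lemma top_par (S : {set V}) v : S \subset N -> v \in S -> top S (par v) = top S v.
Proof.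
move=> SN vS; have -> : par v = climb S v by rewrite /climb vS.
by rewrite /top -iterSr iterS {1}/climb (negPf (topN v SN)).
Qed.

Lemma const_on_top (C : eqType) (S : {set V}) (k : V -> C) : S \subset N ->
  (forall v, v \in S -> k v = k (par v)) <-> (forall v, k (top S v) = k v).
Proof.
move=> SN; split=> [hk v|hk v vS]; last by rewrite -hk -top_par ?hk.
rewrite /top; elim: (\max_u _)%N => //= i <-.
by rewrite {1}/climb; case: ifP => // /hk ->.
Qed.

Lemma mem_tops (S : {set V}) v : (v \in tops S) = (v \notin S).
Proof. by rewrite mem_sort mem_enum inE. Qed.

Lemma uniq_tops (S : {set V}) : uniq (tops S).
Proof. by rewrite sort_uniq enum_uniq. Qed.

Lemma size_forest_type (S : {set V}) : size (forest_type S) = (#|V| - #|S|)%N.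
Proof. by rewrite size_map size_sort -cardE cardsCs setCK. Qed.

Lemma forest_type_part (S : {set V}) : S \subset N -> is_part (forest_type S).
Proof.
move=> SN; apply/andP; split.
  by rewrite sorted_map; apply: sort_sorted => a b; apply: leq_total.
apply/allP => _ /mapP[u + ->]; rewrite mem_tops => uS.
by apply/card_gt0P; exists u; rewrite inE top_id.
Qed.

Lemma sumn_forest_type (S : {set V}) : S \subset N -> sumn (forest_type S) = #|V|.
Proof.
move=> SN; rewrite sumnE big_map /=.
rewrite (perm_big (enum (~: S))) /=; last by rewrite perm_sort.
rewrite big_enum /= -sum1_card [RHS](partition_big (top S) (mem (~: S))) /=; last first.
  by move=> v _; rewrite inE topN.
apply: eq_bigr => u _; rewrite /block -sum1_card; apply: eq_bigl => v.
by rewrite inE.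
Qed.

(** A colouring constant along the edges of [S] is a colouring of the components, each weighted by
    its size, which is what [pcoef] counts. *)
Lemma card_const_colourings (S : {set V}) mu : S \subset N ->
  #|[set k : {ffun V -> 'I_(size mu)} | [forall v in S, k v == k (par v)] &&
      [forall i : 'I_(size mu), (\sum_(v | k v == i) 1)%N == nth 0%N mu i]]|%:R
  = pcoef (forest_type S) mu.
Proof.
move=> SN; rewrite /pcoef; congr (_%:R).
(* [vtx] sends a position in the type to the top it stands for; [idx] sends any vertex to the
   position of its component. *)
pose vtx (i : 'I_(size (forest_type S))) := tnth (in_tuple (tops S)) (cast_ord (size_map (block S) (tops S)) i).
have idx_lt v : (index (top S v) (tops S) < size (forest_type S))%N.
  by rewrite size_map index_mem mem_tops topN.
pose idx v : 'I_(size (forest_type S)) := Ordinal (idx_lt v).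
have vtxE i v : vtx i = nth v (tops S) i by rewrite /vtx (tnth_nth v).
have vtx_idx v : vtx (idx v) = top S v.
  by rewrite (vtxE _ v) /= nth_index // mem_tops topN.
have vtxS i : vtx i \notin S by rewrite -mem_tops mem_tnth.
have idx_vtx i : idx (vtx i) = i.
  apply: val_inj; rewrite /= top_id // (vtxE _ (vtx i)) index_uniq ?uniq_tops //.
  by have := ltn_ord i; rewrite {2}size_map.
have nthE (i : 'I_(size (forest_type S))) : nth 0%N (forest_type S) i = block S (vtx i).
  by rewrite (vtxE _ (vtx i)) (nth_map (vtx i)) //; have := ltn_ord i; rewrite {2}size_map.
pose F (k : {ffun 'I_(size (forest_type S)) -> 'I_(size mu)}) := [ffun v => k (idx v)].
have Finj : injective F.
  by move=> k1 k2 /ffunP e; apply/ffunP => i; have := e (vtx i); rewrite !ffunE idx_vtx.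
rewrite -(card_imset _ Finj); apply: eq_card => k; rewrite inE.
have content (k' : {ffun 'I_(size (forest_type S)) -> 'I_(size mu)}) i :
    (\sum_(v | F k' v == i) 1)%N = (\sum_(j | k' j == i) nth 0%N (forest_type S) j)%N.
  rewrite (partition_big idx (fun j => k' j == i)) /=; last by move=> v; rewrite ffunE.
  apply: eq_bigr => j /eqP kj; rewrite nthE /block -sum1_card; apply: eq_bigl => v.
  rewrite inE ffunE -vtx_idx (can_eq idx_vtx).
  by have [->|_] := eqVneq (idx v) j; rewrite ?kj ?eqxx ?andbF.
apply/andP/imsetP => [[/forall_inP hS /forallP hc]|[k']].
  have kE : k = F [ffun i => k (vtx i)].
    apply/ffunP => v; rewrite !ffunE vtx_idx; apply/esym.
    by move: v; apply/(const_on_top _ SN) => v vS; apply/eqP/hS.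
  exists [ffun i => k (vtx i)] => //; rewrite inE; apply/forallP => i.
  by rewrite -content -kE.
rewrite inE => /forallP hc ->; split; last by apply/forallP => i; rewrite content.
apply/forall_inP => v vS; rewrite !ffunE; apply/eqP; congr (k' _).
by apply: val_inj; rewrite /= top_par.
Qed.

Lemma Xcoef_forest (e : rel V) mu :
  (forall u v, e u v = (u \in N) && (par u == v) || (v \in N) && (par v == u)) ->
  Xcoef e (fun _ => 1%N) mu =
  \sum_(S : {set V} | S \subset N) (-1) ^+ #|S| * pcoef (forest_type S) mu.
Proof.
move=> eE; pose content (k : {ffun V -> 'I_(size mu)}) :=
  [forall i : 'I_(size mu), (\sum_(v | k v == i) 1)%N == nth 0%N mu i].
(* Edges are indexed by their child in [N], so properness is a product with one factor per edge. *)
have properE k : (Defs.proper e k)%:R =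
    \prod_(v in N) (- (k v == k (par v))%:R + 1) :> rat.
  rewrite (eq_bigr (fun v => (k v != k (par v))%:R)); last first.
    by move=> v _; case: eqP; rewrite ?addNr // oppr0 add0r.
  rewrite prod_natr_bool; congr (_%:R); congr nat_of_bool.
  apply/forallP/forall_inP => /= [hp v vN|hp u].
    by have /forallP/(_ (par v)) := hp v; rewrite eE vN eqxx.
  apply/forallP => v; rewrite eE; apply/implyP.
  by case/orP=> /andP[/hp + /eqP <-]; rewrite // eq_sym.
rewrite /Xcoef -sum1_card natr_sum.
transitivity (\sum_(k | content k) (Defs.proper e k)%:R : rat).
  rewrite [RHS]big_mkcond /= big_mkcond /=; apply: eq_bigr => k _.
  by rewrite inE /content; case: Defs.proper; case: [forall i, _].
rewrite (eq_bigr (fun k : {ffun V -> 'I_(size mu)} => \sum_(S : {set V} | S \subset N)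
    (-1) ^+ #|S| * [forall v in S, k v == k (par v)]%:R)); last first.
  move=> k _; rewrite properE prod_add_subsets; apply: eq_bigr => S _.
  rewrite [X in _ * X]big1 // mulr1 -prod_natr_bool -prodr_const -big_split /=.
  by apply: eq_bigr => v _; rewrite mulN1r.
rewrite exchange_big /=; apply: eq_bigr => S SN.
rewrite -mulr_sumr -card_const_colourings //; congr (_ * _).
rewrite -sum1_card natr_sum.
rewrite [RHS]big_mkcond /= big_mkcond /=; apply: eq_bigr => k _.
by rewrite inE /content andbC; case: [forall i, _]; case: [forall v in S, _].
Qed.

(** The type of [S] has [|V| - |S|] parts; once [x^(|V|-|N|)] is factored out, the sum is the subset
    expansion of the product of [(1 - x) + x] over [N]. *)
Lemma tau_forest (R : comPzRingType) (x : R) :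
  \sum_(S : {set V} | S \subset N) (-1) ^+ #|S| *
     (x ^+ size (forest_type S) * (x - 1) ^+ (#|V| - size (forest_type S)))
  = x ^+ (#|V| - #|N|).
Proof.
transitivity (x ^+ (#|V| - #|N|) * \prod_(v in N) ((1 - x) + x)); last first.
  by rewrite big1 ?mulr1 // => v _; rewrite subrK.
rewrite prod_add_subsets mulr_sumr; apply: eq_bigr => S SN.
rewrite size_forest_type !prodr_const cardsD (setIidPr SN).
rewrite [_ ^+ #|S| * _ ^+ (_ - _)]mulrC [RHS]mulrA -exprD.
have SV := max_card (mem S); have NV := max_card (mem N).
have cS := subset_leq_card SN.
rewrite addnBA // subnK // subKn // mulrCA -exprMn; congr (_ * _).
by rewrite mulN1r opprB.
Qed.

End RootedForest.

(** * Rooting paths and trees *)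

(** The height [h] forces climbing to end at vertex 0, where the value of [par] is left
    arbitrary. *)
Definition rooted_at0 n (e : rel 'I_n) (par : 'I_n -> 'I_n) (h : 'I_n -> nat) : Prop :=
  (forall v : 'I_n, v != 0%N :> nat -> (h (par v) < h v)%N) /\
  (forall u v : 'I_n, e u v = (u != 0%N :> nat) && (par u == v) ||
                       (v != 0%N :> nat) && (par v == u)).

Lemma path_rooted n : exists par h, rooted_at0 (@path_rel n) par h.
Proof.
have pred_lt (i : 'I_n) : (i.-1 < n)%N := leq_ltn_trans (leq_pred i) (ltn_ord i).
exists (fun i => Ordinal (pred_lt i)), (@nat_of_ord n); split => [v|u v] /=.
  by rewrite -lt0n => v0; rewrite prednK.
rewrite /path_rel orbC -!val_eqE /=; congr orb.
  by case: (u : nat) => //= m; rewrite eqSS eq_sym.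
by case: (v : nat) => //= m; rewrite eqSS eq_sym.
Qed.

(** Here [h] is the distance from the root and [par v] a neighbour closer to it. Parent edges alone
    connect all vertices, so any further edge would close a cycle. *)
Lemma tree_rooted n (e : rel 'I_n) : (0 < n)%N -> is_tree e ->
  exists par h, rooted_at0 e par h.
Proof.
move=> n_gt0 [esym eirr econn eacyc]; pose r : 'I_n := Ordinal n_gt0.
have r0 (v : 'I_n) : (v != 0%N :> nat) = (v != r) by rewrite -val_eqE.
pose reach v m := [exists p : m.-tuple 'I_n, path e r p && (last r p == v)].
have reachP v p : path e r p -> last r p = v -> reach v (size p).
  by move=> hp hl; apply/existsP; exists (in_tuple p); rewrite hp hl eqxx.
have ex_reach v : exists m, reach v m.
  by have /connectP[p hp hl] := econn r v; exists (size p); apply: reachP.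
pose h v := ex_minn (ex_reach v).
(* The parent is the penultimate vertex of a shortest walk to [v]. The condition is vacuous at the
   root, so choice yields a total function. *)
have ex_par v : exists u, v != r -> e u v && (h u < h v)%N.
  have [->|vr] := eqVneq v r; first by exists r.
  suff [u hu] : exists u, e u v && (h u < h v)%N by exists u.
  rewrite {2}/h; case: ex_minnP => m /existsP[p /andP[hp /eqP hl]] _.
  have := size_tuple p; case/lastP: (val p) hp hl => [|q x] /=.
    by move=> _ rv; rewrite rv eqxx in vr.
  rewrite rcons_path last_rcons size_rcons => /andP[hq ex] xv <-.
  exists (last r q); rewrite -xv ex /h; case: ex_minnP => k _ /(_ (size q)).
  by apply; apply: reachP.
have {ex_par}[par parP] := fin_all_exists ex_par.
pose e' u v := (u != r) && (par u == v) || (v != r) && (par v == u).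
have e'sym : symmetric e' by move=> u v; rewrite /e' orbC.
have e'e u v : e' u v -> e u v.
  by case/orP=> /andP[/parP/andP[h1 _] /eqP <-] //; rewrite esym.
have conn_r v : connect e' v r.
  have [k] := ubnP (h v); elim: k => // k IH in v *; rewrite ltnS => hk.
  have [->//|vr] := eqVneq v r; have /andP[_ lt] := parP v vr.
  apply: (@connect_trans _ _ (par v)); last by apply: IH; apply: leq_trans lt hk.
  by apply: connect1; rewrite /e' vr eqxx.
have e'conn u v : connect e' u v.
  by apply: connect_trans (conn_r u) _; rewrite (sym_connect_sym e'sym).
exists par, h; split => [v|u v]; first by rewrite r0 => /parP/andP[].
rewrite !r0 -/(e' u v); apply/idP/idP; last exact: e'e.
(* A simple path of parent edges from u to v closes up with the edge v u. *)
move=> euv; have /connectP[q hq vq] := e'conn u v.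
case: (shortenP hq) vq => p hp up _ vp.
case: p hp up vp => [|x [|y p]] hp up vp.
- by move: euv; rewrite vp /= eirr.
- by move: hp; rewrite vp /= andbT.
have /negP[] := eacyc (u :: x :: y :: p) up isT.
rewrite /cycle rcons_path -vp esym euv andbT.
by apply: sub_path hp => a b; apply: e'e.
Qed.

(** * Power sum expansion of a forest of trees *)

(** The image of [p_nu] under the specialization computing tau; on a partition the subtraction is
    never truncated. *)
Definition tau_weight (nu : seq nat) : {poly rat} :=
  'X ^+ size nu * ('X - 1) ^+ (sumn nu - size nu).

(* A nu is the coefficient of p_nu in X_{T_l}. *)
Definition p_expansion (t : forall n, rel 'I_n) (l : seq nat) (A : seq nat -> rat) : Prop :=
  [/\ forall nu, A nu != 0 -> [/\ is_part nu, sumn nu = sumn l &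
                                  nu = l \/ (size l < size nu)%N],
      A l != 0 &
      forall s, uniq s -> (forall nu, is_part nu -> sumn nu = sumn l -> nu \in s) ->
        (forall mu, XT t l mu = \sum_(nu <- s) A nu * pcoef nu mu) /\
        \sum_(nu <- s) (A nu)%:P * tau_weight nu = 'X ^+ size l].

(** Groups the edge subsets by type; [f] will be the identity for coefficients and [polyC] for
    tau. *)
Lemma sum_fibers (R : nzRingType) (I : finType) (P : pred I) (T : eqType) (ty : I -> T)
    (c : I -> rat) (f : rat -> R) (F : T -> R) (s : seq T) :
  (forall i, P i -> ty i \in s) -> uniq s -> f 0 = 0 -> {morph f : x y / x + y} ->
  \sum_(nu <- s) f (\sum_(i | P i && (ty i == nu)) c i) * F nu =
  \sum_(i | P i) f (c i) * F (ty i).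
Proof.
move=> tys us f0 fD.
under eq_bigr => nu _.
  rewrite (big_morph f fD f0) mulr_suml big_mkcondr /=; over.
rewrite exchange_big /=; apply: eq_bigr => i Pi.
rewrite (bigD1_seq (ty i)) ?tys //= eqxx big1 ?addr0 // => nu.
by rewrite eq_sym => /negPf ->.
Qed.

(** Parents and heights are taken componentwise on the disjoint union. The full edge set [N] has
    type [l], and a proper subset leaves more components, so the coefficient at [l] comes from [N]
    alone and is a sign. *)
Lemma ex_p_expansion (t : forall n, rel 'I_n) l :
  (forall n, (0 < n)%N -> exists par h, rooted_at0 (t n) par h) -> is_part l ->
  exists A, p_expansion t l A.
Proof.
move=> ht hl.
have /fin_all_exists[p] : forall i : 'I_(size l),
    exists par, exists h, rooted_at0 (t (nth 0%N l i)) par h.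
  by move=> i; apply: ht; apply: part_nth_gt0.
case/fin_all_exists=> hh hp.
pose V := uvert l.
pose par (u : V) : V := Tagged (fun i : 'I_(size l) => 'I_(nth 0%N l i)) (p (tag u) (tagged u)).
pose h (u : V) := hh (tag u) (tagged u).
pose N : {set V} := [set u : V | tagged u != 0%N :> nat].
have par_lt : {in N, forall v, h (par v) < h v}%N.
  by move=> [i a]; rewrite inE /h /= => a0; apply: (hp i).1.
have edgeE u v : uedge t u v = (u \in N) && (par u == v) || (v \in N) && (par v == u).
  case: u v => [i a] [j b]; rewrite /uedge !inE /=.
  have [eij|nij] := eqVneq i j; last first.
    rewrite /= -!tag_eqE /tag_eq /= (negPf nij) [j == i]eq_sym (negPf nij).
    by rewrite !andbF.
  by subst j; rewrite tagged_asE !eq_Tagged /= (hp i).2.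
pose ty := forest_type par h.
have cardV : #|V| = sumn l.
  by rewrite card_tagged sumnE big_map big_enum /= -sum_nth_sumn; apply: eq_bigr => i; rewrite card_ord.
have tag_top v : tag (top par h N v) = tag v.
  rewrite /top; elim: (\max_u _)%N => //= m IH.
  by rewrite /climb; case: ifP.
(* The root of the [i]-th tree, which exists because parts are positive. *)
pose rho (i : 'I_(size l)) : V :=
  Tagged (fun i : 'I_(size l) => 'I_(nth 0%N l i)) (Ordinal (part_nth_gt0 hl (ltn_ord i))).
have rho_inj : injective rho by move=> i j /(congr1 tag).
have rhoE u : (u \notin N) = (u == rho (tag u)).
  by case: u => i a; rewrite inE negbK /rho /= eq_Tagged /= -val_eqE.
(* Climbing never leaves a tree, so the components of [N] are the whole trees. *)
have tyN : ty N = l.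
  apply: part_perm_eq => //; first exact: forest_type_part.
  have perm_rho : perm_eq (tops par h N) [seq rho i | i <- enum 'I_(size l)].
    apply: uniq_perm; rewrite ?uniq_tops ?(map_inj_uniq rho_inj) ?enum_uniq //.
    move=> u; rewrite mem_tops rhoE; apply/eqP/mapP => [->|[i _ -> //]].
    by exists (tag u); rewrite ?mem_enum.
  have blockE i : block par h N (rho i) = nth 0%N l i.
    pose tg := @Tagged _ i (fun i : 'I_(size l) => 'I_(nth 0%N l i)).
    have tg_inj : injective tg by move=> a b /eqP; rewrite eq_Tagged => /eqP.
    rewrite /block -[RHS]card_ord -cardsT -(card_imset _ tg_inj).
    apply: eq_card => v; rewrite inE.
    have := topN par_lt v (subxx N); rewrite rhoE tag_top => /eqP ->.
    rewrite (inj_eq rho_inj); apply/eqP/imsetP => [|[a _ ->] //].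
    by case: v => j a /= ji; subst j; exists a.
  rewrite -[X in perm_eq _ X]map_nth_enum.
  have <- : [seq block par h N u | u <- [seq rho i | i <- enum 'I_(size l)]] =
            [seq nth 0%N l (val i) | i <- enum 'I_(size l)].
    by rewrite -[LHS]map_comp; apply/eq_in_map => i _ /=.
  exact: perm_map.
pose A nu := \sum_(S : {set V} | (S \subset N) && (ty S == nu)) (-1) ^+ #|S| : rat.
have sizeS (S : {set V}) : S \subset N -> S != N -> (size l < size (ty S))%N.
  move=> SN nSN; rewrite -tyN !size_forest_type.
  have := proper_card (A := S) (B := N); rewrite properEneq nSN SN => /(_ isT) lt.
  by rewrite ltn_sub2l // (leq_trans lt) ?max_card.
exists A; split.
- move=> nu; rewrite /A; case: (pickP (fun S : {set V} => (S \subset N) && (ty S == nu))) => [S|h0].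
    case/andP=> SN /eqP <- _; split; first exact: forest_type_part.
      by rewrite (sumn_forest_type par_lt SN).
    by have [->|/(sizeS S SN)] := eqVneq S N; [left|right].
  by rewrite big_pred0 ?eqxx.
- rewrite /A (big_pred1 N) ?signr_eq0 // => S /=.
  have [->|nSN] := eqVneq S N; first by rewrite subxx tyN eqxx.
  apply/negbTE/negP => /andP[SN /eqP e]; have := sizeS _ SN nSN.
  by rewrite e ltnn.
move=> s us hs.
have tys (S : {set V}) : S \subset N -> ty S \in s.
  by move=> SN; apply: hs; rewrite ?(sumn_forest_type par_lt SN) //; apply: forest_type_part SN.
split=> [mu|].
  rewrite /XT /Xg (Xcoef_forest par_lt mu edgeE).
  by rewrite (sum_fibers (f := id) _ _ tys us).
rewrite (sum_fibers (f := polyC) _ _ tys us) //; last exact: polyCD.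
rewrite -tyN size_forest_type -(tau_forest par h N); apply: eq_bigr => S SN.
by rewrite rmorphXn rmorphN rmorph1 /tau_weight (sumn_forest_type par_lt SN).
Qed.

(** * Partitions of bounded sum and transition matrices *)

(** A partition of sum at most [n] has at most [n] parts, each at most [n]. Sorting by length makes
    the transition matrices triangular. *)
Definition parts_upto n : seq (seq nat) :=
  sort (relpre size leq)
    (undup [seq l <- [seq map val (b : seq 'I_n.+1) | b : {bseq n of 'I_n.+1}] |
             is_part l && (sumn l <= n)%N]).

Lemma size_part_le l : is_part l -> (size l <= sumn l)%N.
Proof.
case/andP=> _; elim: l => //= x l IH /andP[x0 /IH le].
by rewrite -add1n leq_add.
Qed.

Lemma mem_leq_sumn l x : x \in l -> (x <= sumn l)%N.
Proof.
elim: l => //= y l IH; rewrite inE => /orP[/eqP ->|/IH le]; first exact: leq_addr.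
exact: leq_trans le (leq_addl _ _).
Qed.

Lemma mem_parts_upto n l : (l \in parts_upto n) = is_part l && (sumn l <= n)%N.
Proof.
rewrite mem_sort mem_undup mem_filter; apply: andb_idr => /andP[hl ln].
have hb : (size [seq inord x : 'I_n.+1 | x <- l] <= n)%N.
  by rewrite size_map (leq_trans (size_part_le hl)).
apply/mapP; exists (Bseq hb); first by rewrite mem_enum.
rewrite /= -map_comp -[LHS]map_id; apply/eq_in_map => x /mem_leq_sumn xl /=.
by rewrite inordK // ltnS (leq_trans xl).
Qed.

Lemma uniq_parts_upto n : uniq (parts_upto n).
Proof. by rewrite sort_uniq undup_uniq. Qed.

Definition part_at n (i : 'I_(size (parts_upto n))) := nth [::] (parts_upto n) i.

Lemma part_atP n i : is_part (@part_at n i) && (sumn (part_at i) <= n)%N.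
Proof. by rewrite -mem_parts_upto mem_nth. Qed.

Lemma part_at_inj n : injective (@part_at n).
Proof.
move=> i j /eqP; rewrite nth_uniq ?uniq_parts_upto // => /eqP; exact: val_inj.
Qed.

Lemma part_at_surj n l : is_part l -> (sumn l <= n)%N -> exists i, @part_at n i = l.
Proof.
move=> hl ln; have lP : l \in parts_upto n by rewrite mem_parts_upto hl.
have il : (index l (parts_upto n) < size (parts_upto n))%N by rewrite index_mem.
by exists (Ordinal il); rewrite /part_at nth_index.
Qed.

Lemma size_part_at n (i j : 'I_(size (parts_upto n))) :
  (i <= j)%N -> (size (part_at i) <= size (part_at j))%N.
Proof.
move=> ij; have tr : transitive (relpre (@size nat) leq).
  by move=> a b c; apply: leq_trans.
have rf : reflexive (relpre (@size nat) leq) by move=> a /=.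
have st : sorted (relpre (@size nat) leq) (parts_upto n).
  by apply: sort_sorted => a b; apply: leq_total.
exact: (sorted_leq_nth tr rf [::] st _ _ (ltn_ord i) (ltn_ord j) ij).
Qed.

Definition pmatrix n : 'M[rat]_(size (parts_upto n)) :=
  \matrix_(i, j) pcoef (part_at i) (part_at j).

(** By [pcoef_neq0], power sums involve only shorter partitions off the diagonal, so this matrix is
    lower triangular. *)
Lemma pmatrix_unit n : pmatrix n \in unitmx.
Proof.
rewrite unitmxE det_trig; last first.
  apply/is_trig_mxP => i j ij; rewrite mxE; apply: contraTeq ij => nz.
  have [/andP[hi _] /andP[hj _]] := (part_atP i, part_atP j).
  have [_ [/part_at_inj ->|lt]] := pcoef_neq0 hi hj nz; first by rewrite ltnn.
  by rewrite -leqNgt ltnW // ltnNge; apply: contraL lt => /size_part_at; rewrite leqNgt.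
by rewrite unitfE prodf_seq_neq0; apply/allP => i _; rewrite mxE pcoef_diag.
Qed.

Lemma ex_tmatrix (t : forall n, rel 'I_n) n :
  (forall m, (0 < m)%N -> exists par h, rooted_at0 (t m) par h) ->
  exists2 M : 'M[rat]_(size (parts_upto n)), M \in unitmx &
    forall i, (forall mu, XT t (part_at i) mu = \sum_j M i j * pcoef (part_at j) mu) /\
      \sum_j (M i j)%:P * tau_weight (part_at j) = 'X ^+ size (part_at i).
Proof.
move=> ht; have /fin_all_exists[A hA] :
    forall i : 'I_(size (parts_upto n)), exists A, p_expansion t (part_at i) A.
  by move=> i; apply: ex_p_expansion ht _; case/andP: (part_atP i).
exists (\matrix_(i, j) A i (part_at j)).
  (* Off the diagonal only longer types occur, so this matrix is upper triangular and its transpose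
     is used. *)
  rewrite -unitmx_tr unitmxE det_trig; last first.
    apply/is_trig_mxP => i j ij; rewrite !mxE; apply: contraTeq ij => nz.
    have [/(_ _ nz)[_ _ [/part_at_inj ->|lt]] _ _] := hA j; first by rewrite ltnn.
    by rewrite -leqNgt ltnW // ltnNge; apply: contraL lt => /size_part_at; rewrite leqNgt.
  rewrite unitfE prodf_seq_neq0; apply/allP => i _; rewrite !mxE.
  by case: (hA i).
move=> i; have [_ _ /(_ _ (uniq_parts_upto n))[]] := hA i.
  move=> nu hnu es; rewrite mem_parts_upto hnu es /=.
  by case/andP: (part_atP i).
move=> hX htau; split=> [mu|].
  by rewrite hX (big_nth [::]) big_mkord; apply: eq_bigr => j _; rewrite mxE.
by rewrite -htau (big_nth [::]) big_mkord; apply: eq_bigr => j _; rewrite mxE.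
Qed.

(** * Linear combinations as row vectors *)

(** The cut to 0 is needed because [a] may take any value outside [s]. *)
Definition coef_row n (s : seq (seq nat)) (a : seq nat -> rat) :
    'rV[rat]_(size (parts_upto n)) :=
  \row_i (if part_at i \in s then a (part_at i) else 0).

Lemma sum_coef_row (R : nzRingType) (f : {rmorphism rat -> R}) n s a (F : seq nat -> R) :
  valid_idx s -> all (fun l => sumn l <= n)%N s ->
  \sum_(l <- s) f (a l) * F l = \sum_i f (coef_row n s a 0 i) * F (part_at i).
Proof.
move=> [us /allP ps] /allP ls.
have pe : perm_eq s [seq l <- parts_upto n | l \in s].
  apply: uniq_perm; rewrite ?filter_uniq ?uniq_parts_upto // => l.
  rewrite mem_filter mem_parts_upto; case ls' : (l \in s) => //=.
  by rewrite ps // ls.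
rewrite (perm_big _ pe) big_filter big_mkcond /= (big_nth [::]) big_mkord.
apply: eq_bigr => i _; rewrite mxE -/(part_at i).
by case: ifP; rewrite ?rmorph0 ?mul0r.
Qed.

Lemma lincomb_row n s a (B : seq nat -> symf) mu :
  valid_idx s -> all (fun l => sumn l <= n)%N s ->
  lincomb s a B mu = \sum_i coef_row n s a 0 i * B (part_at i) mu.
Proof. exact: (sum_coef_row idfun). Qed.

Lemma lincomb_mul n (t : forall m, rel 'I_m) (M : 'M[rat]_(size (parts_upto n)))
    (v : 'rV[rat]_(size (parts_upto n))) mu :
  (forall i, XT t (part_at i) mu = \sum_j M i j * pcoef (part_at j) mu) ->
  \sum_i v 0 i * XT t (part_at i) mu = \sum_j (v *m M) 0 j * pcoef (part_at j) mu.
Proof.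
move=> hM; under eq_bigr => i _ do rewrite hM mulr_sumr.
rewrite exchange_big /=; apply: eq_bigr => j _.
by rewrite mxE mulr_suml; apply: eq_bigr => i _; rewrite mulrA.
Qed.

Lemma tau_row n (M : 'M[rat]_(size (parts_upto n))) (v : 'rV[rat]_(size (parts_upto n))) :
  (forall i, \sum_j (M i j)%:P * tau_weight (part_at j) = 'X ^+ size (part_at i)) ->
  \sum_i (v 0 i)%:P * 'X ^+ size (part_at i) =
  \sum_j ((v *m M) 0 j)%:P * tau_weight (part_at j).
Proof.
move=> hM; under eq_bigr => i _ do rewrite -hM mulr_sumr.
rewrite exchange_big /=; apply: eq_bigr => j _.
rewrite mxE rmorph_sum mulr_suml; apply: eq_bigr => i _.
by rewrite mulrA rmorphM.
Qed.

Lemma ex_sumn_bound (s : seq (seq nat)) : exists n, all (fun l => sumn l <= n)%N s.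
Proof.
exists (\max_(l <- s) sumn l); apply/allP => l ls.
exact: leq_bigmax_seq.
Qed.

(** Evaluating at the partitions of sum at most [n] says that [v] times the invertible [pmatrix n]
    vanishes. *)
Lemma pcoef_sum_inj n (v : 'rV[rat]_(size (parts_upto n))) :
  (forall mu, is_part mu -> \sum_j v 0 j * pcoef (part_at j) mu = 0) -> v = 0.
Proof.
move=> hv; apply: (can_inj (mulmxK (pmatrix_unit n))); rewrite mul0mx.
apply/rowP => j; rewrite !mxE -[RHS](hv (part_at j)); last by case/andP: (part_atP j).
by apply: eq_bigr => i _; rewrite mxE.
Qed.

(** * Basis property and comparison of the two expansions *)

Theorem theorem3p1 (t : forall n : nat, rel 'I_n)
  (ht : forall n : nat, (0 < n)%N -> is_tree (t n)) :
  (* {X_{T_lambda}} spans Lambda ... *)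
  (forall f : symf, in_Lambda f ->
     exists (s : seq (seq nat)) (a : seq nat -> rat),
       valid_idx s /\ sym_eq f (lincomb s a (XT t))) /\
  (* ... and is linearly independent *)
  (forall (s : seq (seq nat)) (a : seq nat -> rat), valid_idx s ->
     sym_eq (lincomb s a (XT t)) (fun _ => 0) ->
     forall l, l \in s -> a l = 0) /\
  (* coefficient identity for every weighted graph and every k *)
  (forall (V : finType) (e : rel V) (w : V -> nat),
     symmetric e -> irreflexive e -> (forall v, (0 < w v)%N) ->
     forall (s : seq (seq nat)) (a : seq nat -> rat)
            (s' : seq (seq nat)) (b : seq nat -> rat),
       valid_idx s -> valid_idx s' ->
       sym_eq (Xg e w) (lincomb s a (XT t)) ->
       sym_eq (Xg e w) (lincomb s' b (XT path_rel)) ->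
       (forall k : nat,
          \sum_(l <- s | size l == k) a l = \sum_(l <- s' | size l == k) b l) /\
       \sum_(l <- s) a l *: ('X^(size l) : {poly rat})
         = \sum_(l <- s') b l *: ('X^(size l) : {poly rat})).
Proof.
have hr n : (0 < n)%N -> exists par h, rooted_at0 (t n) par h.
  by move=> n0; apply: tree_rooted => //; apply: ht.
split; [|split].
- move=> f [n fn]; have [M uM hM] := ex_tmatrix n hr.
  (* Monomial coordinates are turned into power sum coordinates, then into tree coordinates. *)
  pose v := \row_j f (part_at j) *m invmx (pmatrix n) *m invmx M.
  (* The sum has one term, as [part_at] is injective; it reads [v] at the position of [l]. *)
  exists (parts_upto n), (fun l => \sum_(i | part_at i == l) v 0 i).
  have valid : valid_idx (parts_upto n).
    split; first exact: uniq_parts_upto.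
    by apply/allP => l; rewrite mem_parts_upto => /andP[].
  have bnd : all (fun l => sumn l <= n)%N (parts_upto n).
    by apply/allP => l; rewrite mem_parts_upto => /andP[].
  split=> // mu hmu; rewrite (lincomb_row _ _ _ valid bnd).
  have -> : coef_row n (parts_upto n) (fun l => \sum_(i | part_at i == l) v 0 i) = v.
    apply/rowP => j; rewrite mxE mem_nth //.
    by rewrite (big_pred1 j) // => i; rewrite /= (inj_eq (@part_at_inj n)).
  rewrite (lincomb_mul _ (fun i => (hM i).1 mu)) /v mulmxKV //.
  (* Above degree [n] both sides vanish, because each [p_nu] is homogeneous. *)
  case: (leqP (sumn mu) n) => [le|lt].
    have [j <-] := part_at_surj hmu le.
    have := congr1 (fun w : 'rV_ _ => w 0 j)
      (mulmxKV (pmatrix_unit n) (\row_j f (part_at j))).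
    rewrite [RHS]mxE => <-; rewrite [LHS]mxE; apply: eq_bigr => i _.
    by rewrite [pmatrix n i j]mxE.
  rewrite fn // big1 // => j _; have /andP[hj jn] := part_atP j.
  have [/eqP ->|/(pcoef_neq0 hj hmu)[e _]] := boolP (pcoef (part_at j) mu == 0).
    by rewrite mulr0.
  by move: lt; rewrite e ltnNge jn.
- move=> s a hs h0 l ls; have [n bnd] := ex_sumn_bound s.
  have [M uM hM] := ex_tmatrix n hr.
  have row0 : coef_row n s a = 0.
    apply: (can_inj (mulmxK uM)); rewrite mul0mx; apply: pcoef_sum_inj => mu hmu.
    by rewrite -(lincomb_mul _ (fun i => (hM i).1 mu)) -lincomb_row ?h0.
  have [|i il] := part_at_surj (n := n) (allP hs.2 l ls); first exact: (allP bnd).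
  by have := congr1 (fun w : 'rV_ _ => w 0 i) row0; rewrite !mxE il ls.
move=> V e w _ _ _ s a s' b hs hs' hXa hXb.
have tauE : \sum_(l <- s) a l *: ('X^(size l) : {poly rat})
         = \sum_(l <- s') b l *: ('X^(size l) : {poly rat}).
  have [n] := ex_sumn_bound (s ++ s'); rewrite all_cat => /andP[bs bs'].
  have [M uM hM] := ex_tmatrix n hr.
  have [M' uM' hM'] := ex_tmatrix n (fun m _ => path_rooted m).
  (* Both expansions have the same power sum coordinates, and tau is computed from these alone. *)
  have eqM : coef_row n s a *m M = coef_row n s' b *m M'.
    apply/eqP; rewrite -subr_eq0; apply/eqP/pcoef_sum_inj => mu hmu.
    under eq_bigr => j _ do rewrite mxE [X in _ + X]mxE mulrBl.
    rewrite sumrB -(lincomb_mul _ (fun i => (hM i).1 mu)).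
    rewrite -(lincomb_mul _ (fun i => (hM' i).1 mu)) -!lincomb_row //.
    by rewrite -hXa // -hXb // subrr.
  under eq_bigr => l _ do rewrite -mul_polyC.
  under [RHS]eq_bigr => l _ do rewrite -mul_polyC.
  rewrite (sum_coef_row polyC (n := n)) // (sum_coef_row polyC (n := n)) //.
  by rewrite (tau_row _ (fun i => (hM i).2)) (tau_row _ (fun i => (hM' i).2)) eqM.
(* The identity for each [k] is the equality of the coefficients of ['X^k]. *)
split=> // k; have := congr1 (fun p : {poly rat} => p`_k) tauE.
rewrite !coef_sum [X in X = _ -> _](_ : _ = \sum_(l <- s | size l == k) a l).
  rewrite [X in _ = X -> _](_ : _ = \sum_(l <- s' | size l == k) b l) //.
  rewrite [RHS]big_mkcond /=; apply: eq_bigr => l _.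
  by rewrite coefZ coefXn eq_sym; case: eqP; rewrite ?mulr1 ?mulr0.
rewrite [RHS]big_mkcond /=; apply: eq_bigr => l _.
by rewrite coefZ coefXn eq_sym; case: eqP; rewrite ?mulr1 ?mulr0.
Qed.
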